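(* Let $n$ be even and $S\ge2$. Any randomized AMPC algorithm with I/O capacity $S$ that computes $\mathrm{1v2Cycle}$ on $n$ vertices with error at most $1/6$ requires at least $\frac16\log_S n-\frac12\log_S 2=\Omega(\log_S n)$ rounds. In particular, if $S=n^\epsilon$ for $\epsilon\in(0,1)$, any such algorithm requires $\Omega(1/\epsilon)$ rounds.
   Context: Graphs on vertex set $\{1,\dots,n\}$ are encoded as $x\in\{0,1\}^N$, $N=\binom n2$, one bit per unordered pair (adjacency matrix). $\mathrm{1v2Cycle}:\Delta\to\{0,1\}$ is defined on the set $\Delta$ of graphs that are either a single $n$-cycle (value $1$) or a disjoint union of two cycles of length $n/2$ (value $0$). AMPC model with I/O capacity $S$: computation proceeds in rounds communicating through distributed data stores (DDS) $\mathcal{D}_0,\dots,\mathcal{D}_R$, each storing under each key a multiset of values (possibly empty; duplicates allowed, each value written by a unique machine). On input $x$, $\mathcal{D}_0$ consists of the pairs $(i,x_i)$, $i=1,\dots,N$. In round $r\ge1$ each machine (arbitrarily many, computationally unbounded, deterministic) adaptively queries keys of $\mathcal{D}_{r-1}$, receiving the whole multiset under the key, with later queries depending arbitrarily on earlier ones and their responses; the total number of values in responses plus the number of empty-response queries is at most $S$; it then writes at most $S$ key-value pairs to $\mathcal{D}_r$ as a function of its queries and responses. Algorithms are also run on invalid inputs $x\in\{0,1\}^N\setminus\Delta$ (a machine exceeding its budget stops and writes nothing), and in every round, on every input in $\{0,1\}^N$, at most $S$ values are written under any single key. A deterministic algorithm outputs $b$ on $x$ if $\mathcal{D}_R$ contains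 exactly the single pair $(\textsc{answer},b)$. A randomized AMPC algorithm is a probability distribution over deterministic AMPC algorithms; its number of rounds is the maximum over its support; it computes $g$ with error at most $\delta$ if for each $x\in\Delta$ it outputs $g(x)$ with probability at least $1-\delta$. *)

(* Defs.v *)
From HB Require Import structures.
From mathcomp Require Import all_boot all_order all_algebra.


Set Implicit Arguments.
Unset Strict Implicit.
Unset Printing Implicit Defensive.

(* Graph inputs: vertex set 'I_n (= {1..n} shifted), one bit per       *)
(* unordered pair, in the fixed canonical enumeration [pairs n].       *)

Definition pairs (n : nat) : seq {set 'I_n} :=
  filter (fun A : {set 'I_n} => #|A| == 2) (enum [set: {set 'I_n}]).

Definition npairs (n : nat) : nat := size (pairs n).

(* an input x in {0,1}^N; bit i is the adjacency bit of the pair nth i *)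
Definition input (n : nat) := {ffun 'I_(npairs n) -> bool}.

Definition edge_set (n : nat) (x : input n) : {set {set 'I_n}} :=
  [set A | has (fun i : 'I_(npairs n) => x i && (nth set0 (pairs n) i == A))
               (enum 'I_(npairs n))].

Definition one_cycle (n : nat) (x : input n) : Prop :=
  exists f : nat -> 'I_n, {in [pred i | i < n] &, injective f} /\
    edge_set x = [set [set f (nat_of_ord i); f (i.+1 %% n)] | i : 'I_n].

Definition two_cycles (n : nat) (x : input n) : Prop :=
  let h := n./2 in
  exists f : nat -> 'I_n, {in [pred i | i < n] &, injective f} /\
    edge_set x =
      [set [set f (nat_of_ord i); f (i.+1 %% h)] | i : 'I_h] :|:
      [set [set f (h + i); f (h + i.+1 %% h)] | i : 'I_h].

(* Delta = one_cycle \/ two_cycles;  1v2Cycle x = true on one_cycle,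
   false on two_cycles. *)

(* AMPC model.  Keys and values are natural numbers.                  *)
(* A DDS maps each key to the multiset of values stored under it,     *)
(* represented by a list (order irrelevant: only perm_eq-invariant    *)
(* information, namely the sorted list, is ever shown to machines).   *)

Definition store := nat -> seq nat.

(* the special key ANSWER; input keys are 1..N *)
Definition answer_key : nat := 0.

(* A deterministic machine: an adaptive query tree.  [Query k c] queries
   key k and continues with c applied to the received multiset (given as
   a sorted list); [Emit w] writes the key-value pairs w. *)
Inductive machine : Type :=
| Query of nat & (seq nat -> machine)
| Emit of seq (nat * nat).

Fixpoint run_machine (D : store) (budget : nat) (t : machine)
  : seq (nat * nat) :=
  match t with
  | Emit w => w
  | Query k c =>
      let cost := maxn 1 (size (D k)) in
      if cost <= budget then run_machine D (budget - cost) (c (sort leq (D k)))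
      else [::]
  end.

(* A deterministic AMPC algorithm: number of rounds, and for each round
   r (1 <= r <= rounds) and machine index m : nat the machine run by m.
   (Countably many machines per round; idle machines emit nothing.) *)
Record algorithm : Type := Algorithm {
  rounds : nat;
  prog : nat -> nat -> machine }.

Definition round_writes (S : nat) (A : algorithm) (r : nat) (D : store)
  : nat -> seq (nat * nat) :=
  fun m => run_machine D S (prog A r m).

Definition key_vals (W : nat -> seq (nat * nat)) (k n0 : nat) : seq nat :=
  flatten [seq [seq p.2 | p <- W m & p.1 == k] | m <- iota 0 n0].

Definition collects (W : nat -> seq (nat * nat)) (D : store) : Prop :=
  forall k, exists n0,
    (forall m, n0 <= m -> all (fun p => p.1 != k) (W m)) /\
    perm_eq (D k) (key_vals W k n0).

Definition init_store (n : nat) (x : input n) : store := fun k =>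
  if (0 < k) && (k <= npairs n)
  then [:: nth 0 [seq nat_of_bool (x i) | i <- enum 'I_(npairs n)] k.-1]
  else [::].

Definition run_upto (S : nat) (A : algorithm) (n : nat) (x : input n)
  (Ds : nat -> store) (t : nat) : Prop :=
  (forall k, perm_eq (Ds 0 k) (init_store x k)) /\
  forall r, 0 < r <= t -> collects (round_writes S A r (Ds r.-1)) (Ds r).

Definition valid_alg (S : nat) (A : algorithm) (n : nat) : Prop :=
  forall (x : input n) (Ds : nat -> store) (r : nat),
    0 < r <= rounds A -> run_upto S A x Ds r.-1 ->
    let W := round_writes S A r (Ds r.-1) in
    (forall m, size (W m) <= S) /\
    (forall k, exists n0,
       (forall m, n0 <= m -> all (fun p => p.1 != k) (W m)) /\
       size (key_vals W k n0) <= S).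

Definition outputs (S : nat) (A : algorithm) (n : nat) (x : input n)
  (b : bool) : Prop :=
  exists Ds, run_upto S A x Ds (rounds A) /\
    perm_eq (Ds (rounds A) answer_key) [:: nat_of_bool b] /\
    (forall k, k != answer_key -> Ds (rounds A) k = [::]).

(* Main.v *)
Require Import Defs.
From HB Require Import structures.
From mathcomp Require Import all_boot all_order all_algebra.
From mathcomp Require boolp classical_sets.

(* Let m = n/2 and arrange the vertices in a cyclic ladder of m columns with two
   vertices each. For a set Z of columns, join column i to column i+1 by two
   parallel edges, crossed exactly when i is in Z. The result is one n-cycle if
   #|Z| is odd and two (n/2)-cycles if it is even, so 1v2Cycle restricted to
   these inputs is the parity of Z, while every input bit depends on at most two
   elements of Z.

   The content of a key after r rounds is a polynomial in Z of degree at most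
   2 S^(2r): a machine makes at most S queries, and a key collects nonempty
   contributions of at most S machines, so a round multiplies the degree by at
   most S * S. If r is below the claimed bound this is less than m, and a
   polynomial of degree less than m is orthogonal to parity. So a deterministic
   algorithm is right on at most half of the sets Z, and averaging over Z
   contradicts the success probability 5/6 on each of them. *)

Set Implicit Arguments.
Unset Strict Implicit.
Unset Printing Implicit Defensive.
Import Order.TTheory GRing.Theory Num.Theory.

(** * Degree of functions of a finite set *)

Local Open Scope ring_scope.

(* [(B \subset Z)%:R] is the monomial [\prod_(i in B) (i \in Z)%:R]. *)
Definition degree_le (I : finType) (d : nat) (f : {set I} -> int) : Prop :=
  exists2 s : seq (int * {set I}),
    all (fun p : int * {set I} => (#|p.2| <= d)%N) s
    & forall Z, f Z = \sum_(p <- s) p.1 * (p.2 \subset Z)%:R.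

Lemma degree_leW (I : finType) (d d' : nat) (f : {set I} -> int) :
  (d <= d')%N -> degree_le d f -> degree_le d' f.
Proof.
move=> dd' [s sd fE]; exists s => //.
by apply: sub_all sd => p /leq_trans; apply.
Qed.

Lemma eq_degree_le (I : finType) (d : nat) (f g : {set I} -> int) :
  f =1 g -> degree_le d f -> degree_le d g.
Proof. by move=> fg [s sd fE]; exists s => // Z; rewrite -fg. Qed.

Lemma degree_le_cst (I : finType) (d : nat) (c : int) :
  degree_le d (fun _ : {set I} => c).
Proof.
exists [:: (c, set0)] => [|Z]; first by rewrite /= cards0.
by rewrite big_seq1 sub0set mulr1.
Qed.

Lemma degree_le_mem (I : finType) (i : I) :
  degree_le 1 (fun Z : {set I} => (i \in Z)%:R).
Proof.
exists [:: (1, [set i])] => [|Z]; first by rewrite /= cards1.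
by rewrite big_seq1 sub1set mul1r.
Qed.

Lemma degree_leD (I : finType) (d : nat) (f g : {set I} -> int) :
  degree_le d f -> degree_le d g -> degree_le d (fun Z => f Z + g Z).
Proof.
move=> [s sd fE] [t td gE]; exists (s ++ t) => [|Z].
  by rewrite all_cat sd.
by rewrite big_cat fE gE.
Qed.

Lemma degree_leM (I : finType) (d e : nat) (f g : {set I} -> int) :
  degree_le d f -> degree_le e g -> degree_le (d + e) (fun Z => f Z * g Z).
Proof.
move=> [s sd fE] [t te gE].
exists [seq (p.1 * q.1, p.2 :|: q.2) | p <- s, q <- t] => [|Z].
  apply/allP => _ /allpairsP[[p q] /= [ps qt ->]] /=.
  have [pd qe] := (allP sd _ ps, allP te _ qt).
  rewrite cardsU (leq_trans (leq_subr _ _)) //.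
  exact: leq_add.
rewrite big_allpairs_dep /= fE gE big_distrlr /=.
apply: eq_bigr => p _; apply: eq_bigr => q _.
by rewrite subUset -mulnb natrM mulrACA.
Qed.

Lemma degree_le_sum (I : finType) (J : Type) (r : seq J) (d : nat)
    (F : J -> {set I} -> int) :
  (forall j, degree_le d (F j)) -> degree_le d (fun Z => \sum_(j <- r) F j Z).
Proof.
move=> Fd; elim: r => [|j r IH].
  by apply: eq_degree_le (degree_le_cst I d 0) => Z; rewrite big_nil.
by apply: eq_degree_le (degree_leD (Fd j) IH) => Z; rewrite big_cons.
Qed.

(* Toggling the membership of one element outside [B] reverses the sign. *)
Lemma sum_sign_subset (I : finType) (B : {set I}) :
  (#|B| < #|I|)%N ->
  \sum_(Z : {set I}) (-1) ^+ #|Z| * (B \subset Z)%:R = 0 :> int.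
Proof.
move=> ltB.
have [i iB] : exists i, i \notin B.
  apply/existsP; rewrite -negb_forall; apply/negP => /forallP allB.
  suff eB : B = [set: I] by rewrite eB cardsT ltnn in ltB.
  by apply/setP => i; rewrite inE; exact: allB.
pose h (Z : {set I}) := if i \in Z then Z :\ i else i |: Z.
have hK : involutive h.
  move=> Z; rewrite /h; case: (boolP (i \in Z)) => iZ.
    by rewrite !inE eqxx /= setD1K.
  by rewrite setU11 setU1K.
set s := LHS.
have : s = - s.
  rewrite {1}/s (reindex_inj (inv_inj hK)) /= /s -sumrN.
  apply: eq_bigr => Z _.
  have -> : (B \subset h Z) = (B \subset Z).
    rewrite /h; case: ifP => iZ; first by rewrite subsetD1 iB andbT.
    apply/idP/idP => [|/subset_trans]; last by apply; exact: subsetUr.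
    move=> /subsetP sB; apply/subsetP => j jB.
    move: (sB j jB); rewrite !inE => /orP[/eqP ji|//].
    by rewrite -ji jB in iB.
  rewrite -mulNr; congr (_ * _); rewrite /h; case: ifP => iZ.
    by rewrite [in RHS](cardsD1 i) iZ exprS mulN1r opprK.
  by rewrite cardsU1 iZ exprS mulN1r.
move=> /eqP; rewrite -subr_eq0 opprK -mulr2n mulrn_eq0 /=.
by move/eqP.
Qed.

Lemma sum_sign_degree_lt (I : finType) (d : nat) (f : {set I} -> int) :
  (d < #|I|)%N -> degree_le d f ->
  \sum_(Z : {set I}) (-1) ^+ #|Z| * f Z = 0.
Proof.
move=> dI [s sd fE].
under eq_bigr do rewrite fE mulr_sumr.
rewrite exchange_big /= big1_seq // => p /andP[_ ps].
under eq_bigr do rewrite mulrCA.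
rewrite -mulr_sumr sum_sign_subset ?mulr0 //.
exact: leq_ltn_trans (allP sd _ ps) dI.
Qed.

(** Stores and writes are not numbers, so degree is measured through all integer-valued observables
    of the value. *)
Definition obs_degree_le (I : finType) (T : Type) (d : nat) (f : {set I} -> T)
  : Prop := forall g : T -> int, degree_le d (fun Z => g (f Z)).

Lemma obs_degree_leW (I : finType) (T : Type) (d d' : nat) (f : {set I} -> T) :
  (d <= d')%N -> obs_degree_le d f -> obs_degree_le d' f.
Proof. by move=> dd' fd g; exact: degree_leW (fd g). Qed.

Lemma eq_obs_degree_le (I : finType) (T : Type) (d : nat) (f g : {set I} -> T) :
  f =1 g -> obs_degree_le d f -> obs_degree_le d g.
Proof.
by move=> fg fd h; apply: eq_degree_le (fd h) => Z; rewrite fg.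
Qed.

Lemma obs_degree_le_cst (I : finType) (T : Type) (d : nat) (c : T) :
  obs_degree_le d (fun _ : {set I} => c).
Proof. by move=> g; exact: degree_le_cst. Qed.

(** Computation on known data costs no degree, matching computationally unbounded machines. *)
Lemma obs_degree_le_comp (I : finType) (T U : Type) (d : nat) (h : T -> U)
    (f : {set I} -> T) :
  obs_degree_le d f -> obs_degree_le d (fun Z => h (f Z)).
Proof. by move=> fd g; exact: (fd (fun t => g (h t))). Qed.

Lemma obs_degree_le_mem (I : finType) (i : I) :
  obs_degree_le 1 (fun Z : {set I} => i \in Z).
Proof.
move=> g; apply: eq_degree_le (degree_leD (degree_le_cst _ 1 (g false))
  (degree_leM (degree_le_cst _ 0 (g true - g false)) (degree_le_mem i))) => Z.
by case: (i \in Z); rewrite ?mulr1 ?mulr0 ?addr0 // addrC subrK.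
Qed.

Lemma sum_value_indicator (I : finType) (T : eqType) (f : {set I} -> T)
    (F : T -> int) (Z : {set I}) :
  F (f Z) = \sum_(v <- undup [seq f Y | Y <- enum {set I}]) (f Z == v)%:R * F v.
Proof.
rewrite (bigD1_seq (f Z)) ?undup_uniq //=; last first.
  by rewrite mem_undup map_f // mem_enum.
rewrite eqxx mul1r big1 ?addr0 // => v /negbTE.
by rewrite eq_sym => ->; rewrite mul0r.
Qed.

(** This is the cost of adaptivity. Only finitely many values [v] of [f] occur; summing over them
    the indicator of [f Z = v], of degree [d], times [F v Z], the degrees add no matter how many
    values there are. *)
Lemma degree_le_bind (I : finType) (T : eqType) (d e : nat) (f : {set I} -> T)
    (F : T -> {set I} -> int) :
  obs_degree_le d f -> (forall v, degree_le e (F v)) ->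
  degree_le (d + e) (fun Z => F (f Z) Z).
Proof.
move=> fd Fe.
apply: (@eq_degree_le _ _ (fun Z =>
  \sum_(v <- undup [seq f Y | Y <- enum {set I}]) (f Z == v)%:R * F v Z)).
  by move=> Z; rewrite -(sum_value_indicator f (fun v => F v Z)).
apply: degree_le_sum => v; apply: degree_leM => //.
exact: (fd (fun t => (t == v)%:R)).
Qed.

Lemma obs_degree_le_bind (I : finType) (T : eqType) (U : Type) (d e : nat)
    (f : {set I} -> T) (h : T -> {set I} -> U) :
  obs_degree_le d f -> (forall v, obs_degree_le e (h v)) ->
  obs_degree_le (d + e) (fun Z => h (f Z) Z).
Proof.
move=> fd he g; apply: (degree_le_bind (F := fun v Z => g (h v Z))) => // v.
exact: he.
Qed.

(* Unfolding the observable one list at a time, each nonempty list spends one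
   unit of the bound [s] and costs degree [e], while empty lists are free. *)
Lemma degree_le_flatten (I : finType) (T : eqType) (e : nat) (J : Type)
    (r : seq J) (f : J -> {set I} -> seq T) (s : nat) (g : seq T -> int) :
  (forall j, obs_degree_le e (f j)) ->
  exists2 p, degree_le (s * e) p
    & forall Z, (size (flatten [seq f j Z | j <- r]) <= s)%N ->
        p Z = g (flatten [seq f j Z | j <- r]).
Proof.
move=> fe; elim: r s g => [|j r IH] s g.
  by exists (fun=> g [::]) => //; exact: degree_le_cst.
have [p pd pE] := IH s g.
case: s => [|s] in p pd pE *.
  exists (fun=> g [::]); first exact: degree_le_cst.
  by move=> Z; rewrite leqn0 size_eq0 => /eqP ->.
have /boolp.choice[q qP] : forall v, exists q, degree_le (s * e) q /\
    forall Z, (size (flatten [seq f j Z | j <- r]) <= s)%N ->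
    q Z = g (v ++ flatten [seq f j Z | j <- r])
          - g (flatten [seq f j Z | j <- r]).
  by move=> v; have [q qd qE] := IH s (fun l => g (v ++ l) - g l); exists q.
(* [p] treats the head list as empty; [Q] adds the correction when it is not, in which case the
   remaining lists have total size at most [s]. *)
pose Q v Z := if v is [::] then 0 else q v Z.
exists (fun Z => p Z + Q (f j Z) Z).
  apply: degree_leD => //; rewrite mulSn.
  apply: (degree_le_bind (F := Q)) => // v.
  by case: v => [|a v]; [exact: degree_le_cst | exact: (qP _).1].
move=> Z; rewrite /Q /= size_cat; case: (f j Z) => [|a v] /= sz.
  by rewrite addr0 pE.
have sz' : (size (flatten [seq f j Z | j <- r]) <= s)%N.
  by move: sz; rewrite addSn ltnS; apply: leq_trans; exact: leq_addl.
by rewrite pE ?leqW // (qP _).2 // addrC subrK.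
Qed.

Lemma obs_degree_le_flatten (I : finType) (T : eqType) (e : nat) (J : Type)
    (r : seq J) (f : J -> {set I} -> seq T) (s : nat) :
  (forall j, obs_degree_le e (f j)) ->
  (forall Z, (size (flatten [seq f j Z | j <- r]) <= s)%N) ->
  obs_degree_le (s * e) (fun Z => flatten [seq f j Z | j <- r]).
Proof.
move=> fe le_s g; have [p pd pE] := degree_le_flatten r s g fe.
by apply: eq_degree_le pd => Z; rewrite pE.
Qed.

Local Close Scope ring_scope.

(** * Runs of deterministic algorithms *)

Lemma run_machine_perm (D D' : store) (b : nat) (t : machine) :
  (forall k, perm_eq (D k) (D' k)) -> run_machine D b t = run_machine D' b t.
Proof.
move=> DD'; elim: t b => [k c IH|w] b //=.
rewrite (perm_size (DD' k)) (_ : sort leq (D k) = sort leq (D' k)) ?IH //.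
by apply/perm_sort_leP.
Qed.

Definition writes_end (W : nat -> seq (nat * nat)) (k n0 : nat) : Prop :=
  forall m, n0 <= m -> all (fun p => p.1 != k) (W m).

Lemma key_vals_writes_end (W : nat -> seq (nat * nat)) (k n0 n1 : nat) :
  writes_end W k n0 -> n0 <= n1 -> key_vals W k n1 = key_vals W k n0.
Proof.
move=> W0 le01; rewrite /key_vals -(subnKC le01) iotaD map_cat flatten_cat.
rewrite [X in _ ++ X](_ : _ = [::]) ?cats0 //.
apply/eqP; rewrite -size_eq0 size_flatten sumnE big_map big_map.
rewrite big1_seq // => m /andP[_]; rewrite mem_iota => /andP[le0m _].
rewrite size_map; apply/eqP; rewrite size_eq0 -[_ == _]negbK -has_filter.
apply/hasPn => p pm; exact: (allP (W0 m le0m)).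
Qed.

Lemma key_vals_unique (W : nat -> seq (nat * nat)) (k n0 n1 : nat) :
  writes_end W k n0 -> writes_end W k n1 -> key_vals W k n0 = key_vals W k n1.
Proof.
move=> W0 W1; case: (leqP n0 n1) => [|/ltnW] le.
  by rewrite (key_vals_writes_end W0 le).
by rewrite (key_vals_writes_end W1 le).
Qed.

Lemma eq_key_vals (W W' : nat -> seq (nat * nat)) (k n0 : nat) :
  W =1 W' -> key_vals W k n0 = key_vals W' k n0.
Proof.
move=> WW'; rewrite /key_vals; congr flatten.
by apply: eq_map => m; rewrite WW'.
Qed.

Lemma collects_unique (W W' : nat -> seq (nat * nat)) (D D' : store) (k : nat) :
  W =1 W' -> collects W D -> collects W' D' -> perm_eq (D k) (D' k).
Proof.
move=> WW' /(_ k)[n0 [W0 p0]] /(_ k)[n1 [W1 p1]].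
rewrite (perm_trans p0) // perm_sym (perm_trans p1) //.
rewrite (eq_key_vals _ _ WW') (@key_vals_unique W' k n1 n0) //.
by move=> m /W0; rewrite WW'.
Qed.

(** [outputs] only asserts that some run exists; machines see sorted lists, so by induction on the
    round any two runs agree up to permutation. *)
Lemma run_unique (S : nat) (A : algorithm) (n : nat) (x : input n)
    (Ds Ds' : nat -> store) (t : nat) :
  run_upto S A x Ds t -> run_upto S A x Ds' t ->
  forall r k, r <= t -> perm_eq (Ds r k) (Ds' r k).
Proof.
move=> [D0 Dr] [D0' Dr'] r; elim: r => [|r IH] k rt.
  by rewrite (perm_trans (D0 k)) // perm_sym.
apply: (collects_unique _ _ (Dr r.+1 rt) (Dr' r.+1 rt)) => m.
by apply: run_machine_perm => k'; apply: IH; exact: ltnW.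
Qed.

(** [xget] selects some index past which no machine writes to [k]; any such index yields the same
    list. *)
Definition collected (W : nat -> seq (nat * nat)) : store := fun k =>
  key_vals W k (classical_sets.xget 0 (writes_end W k)).

Lemma collected_key_vals (W : nat -> seq (nat * nat)) (k n0 : nat) :
  writes_end W k n0 -> collected W k = key_vals W k n0.
Proof.
move=> W0; apply: key_vals_unique => //.
by apply: (classical_sets.xgetPex 0); exists n0.
Qed.

(** A canonical run, so that the content of a key becomes a function of the input and can have a
    degree. *)
Fixpoint run_store (S : nat) (A : algorithm) (n : nat) (x : input n) (r : nat)
  : store :=
  if r is r'.+1 then collected (round_writes S A r (run_store S A x r'))
  else init_store x.

Lemma run_storeP (S : nat) (A : algorithm) (n : nat) (x : input n) (t : nat) :
  valid_alg S A n -> t <= rounds A -> run_upto S A x (run_store S A x) t.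
Proof.
move=> vA; elim: t => [|t IH] tA; split=> // r.
  by case/andP; case: r.
have {}IH := IH (ltnW tA).
case/andP; case: r => // r _; rewrite leq_eqVlt => /orP[/eqP[->]|rt]; last first.
  exact: IH.2.
move=> k /=; have [//|_] := vA x _ t.+1 _ IH.
move=> /(_ k)[n0 [W0 _]]; exists n0; split=> //.
by rewrite (collected_key_vals W0).
Qed.

Lemma outputs_run_store (S : nat) (A : algorithm) (n : nat) (x : input n)
    (b : bool) :
  valid_alg S A n -> outputs S A x b ->
  run_store S A x (rounds A) answer_key = [:: nat_of_bool b].
Proof.
move=> vA [Ds [DsP [Dsb _]]].
have := run_unique DsP (run_storeP x vA (leqnn _)) answer_key (leqnn _).
by rewrite perm_sym => /perm_trans/(_ Dsb); exact: perm_small_eq.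
Qed.

(** Each query adds [d] to the degree and uses at least one unit of the budget, so induction on the
    query tree, for all budgets at once, gives [b * d]. *)
Lemma run_machine_degree (I : finType) (D : {set I} -> store) (d b : nat)
    (t : machine) :
  (forall k, obs_degree_le d (fun Z => sort leq (D Z k))) ->
  obs_degree_le (b * d) (fun Z => run_machine (D Z) b t).
Proof.
move=> Dd; elim: t b => [k c IH|w] b /=; last exact: obs_degree_le_cst.
case: b => [|b].
  (* Even an empty response costs 1, so with no budget left the query fails and nothing is
     written. *)
  apply: eq_obs_degree_le (obs_degree_le_cst _ _ [::]) => Z.
  by rewrite geq_max.
pose h v Z := if maxn 1 (size v) <= b.+1
  then run_machine (D Z) (b.+1 - maxn 1 (size v)) (c v) else [::].
apply: (@eq_obs_degree_le _ _ _ (fun Z => h (sort leq (D Z k)) Z)).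
  by move=> Z; rewrite /h size_sort.
rewrite mulSn; apply: obs_degree_le_bind => // v.
rewrite /h; case: (_ <= b.+1); last exact: obs_degree_le_cst.
apply: obs_degree_leW (IH _ _); rewrite leq_mul2r leq_subLR.
by rewrite -[b.+1]add1n leq_add2r leq_maxl orbT.
Qed.

Lemma run_store_degree (I : finType) (S : nat) (A : algorithm) (n : nat)
    (x : {set I} -> input n) (d r k : nat) :
  valid_alg S A n -> r <= rounds A ->
  (forall i, obs_degree_le d (fun Z => x Z i)) ->
  obs_degree_le (d * (S * S) ^ r) (fun Z => run_store S A (x Z) r k).
Proof.
move=> vA + xd; elim: r k => [|r IH] k rA.
  rewrite expn0 muln1 /= /init_store.
  case: (boolP ((0 < k) && (k <= npairs n))) => [/andP[k0 kN]|_];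
    last exact: obs_degree_le_cst.
  have kN' : k.-1 < npairs n by rewrite prednK.
  pose i := Ordinal kN'.
  apply: eq_obs_degree_le
    (obs_degree_le_comp (fun b : bool => [:: nat_of_bool b]) (xd i)).
  move=> Z; rewrite (nth_map i) ?size_enum_ord //; congr [:: nat_of_bool (x Z _)].
  by apply: val_inj; rewrite /= nth_enum_ord.
have Wd m : obs_degree_le (S * (d * (S * S) ^ r))
    (fun Z => round_writes S A r.+1 (run_store S A (x Z) r) m).
  apply: run_machine_degree => k'; apply: obs_degree_le_comp; apply: IH.
  exact: ltnW.
pose W Z := round_writes S A r.+1 (run_store S A (x Z) r).
have /boolp.choice[N NP] Z : exists n0,
    (* The cut-off [N Z] depends on [Z], whereas the flattening lemma needs one fixed list of
       machines; the maximum [M] over the finitely many [Z] serves for all of them. *)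
    writes_end (W Z) k n0 /\ size (key_vals (W Z) k n0) <= S.
  by have [//|_ /(_ k)] := vA (x Z) _ r.+1 _ (run_storeP (x Z) vA (ltnW rA)).
pose M := \max_Z N Z.
have kE Z : key_vals (W Z) k M = key_vals (W Z) k (N Z).
  by apply: key_vals_writes_end; [exact: (NP Z).1 | exact: leq_bigmax].
apply: (@eq_obs_degree_le _ _ _ (fun Z => key_vals (W Z) k M)).
  by move=> Z; rewrite kE /= (collected_key_vals (NP Z).1).
rewrite expnS mulnCA -mulnA.
apply: (@obs_degree_le_flatten I nat _ nat (iota 0 M)
  (fun m Z => [seq p.2 | p <- W Z m & p.1 == k])).
  move=> m; exact: (obs_degree_le_comp
    (fun w : seq (nat * nat) => [seq p.2 | p <- w & p.1 == k]) (Wd m)).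
by move=> Z; have := (NP Z).2; rewrite -kE.
Qed.

(** * Twisted ladders *)

(* The vertex in column [i %% m.+1] on side [s] of a ladder with m.+1 columns. *)
Definition vertex (m : nat) (s : bool) (i : nat) : 'I_(m.+1 + m.+1) :=
  inord (s * m.+1 + i %% m.+1).

Definition ladder_edge (m : nat) (s b : bool) (i : nat)
  : {set 'I_(m.+1 + m.+1)} :=
  [set vertex m s i; vertex m (s (+) b) i.+1].

Definition ladder (m : nat) (Z : {set 'I_m.+1})
  : {set {set 'I_(m.+1 + m.+1)}} :=
  [set ladder_edge m p.1 (p.2 \in Z) p.2 | p : bool * 'I_m.+1].

Definition ladder_input (m : nat) (Z : {set 'I_m.+1}) : input (m.+1 + m.+1) :=
  [ffun i : 'I_(npairs (m.+1 + m.+1)) => nth set0 (pairs _) i \in ladder Z].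

Lemma vertexE (m : nat) (s : bool) (i : nat) :
  vertex m s i = s * m.+1 + i %% m.+1 :> nat.
Proof.
have lt_im : i %% m.+1 < m.+1 by rewrite ltn_mod.
have : s * m.+1 + i %% m.+1 < m.+1 + m.+1.
  by rewrite -addnS leq_add //; case: s; rewrite ?mul1n.
exact: inordK.
Qed.

Lemma vertex_mod (m : nat) (s : bool) (i : nat) :
  vertex m s (i %% m.+1) = vertex m s i.
Proof. by rewrite /vertex modn_mod. Qed.

Lemma vertex_col (m : nat) (s : bool) (i : nat) :
  vertex m s i %% m.+1 = i %% m.+1.
Proof. by rewrite vertexE modnMDl modn_mod. Qed.

Lemma vertex_inj (m : nat) (s s' : bool) (i j : nat) :
  vertex m s i = vertex m s' j -> s = s' /\ i = j %[mod m.+1].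
Proof.
move=> e; have eij : i %% m.+1 = j %% m.+1.
  by rewrite -(vertex_col m s) e vertex_col.
split=> //; move/(congr1 (@nat_of_ord _)): e; rewrite !vertexE eij => /eqP.
by rewrite eqn_add2r eqn_mul2r /=; case: s; case: s'.
Qed.

Lemma ladder_edge_card (m : nat) (s b : bool) (i : nat) :
  0 < m -> #|ladder_edge m s b i| = 2.
Proof.
move=> m0; rewrite /ladder_edge cards2; case: eqP => //.
move=> /vertex_inj[_ /eqP]; rewrite -[i.+1]addn1 -{1}[i]addn0 eqn_modDl.
by rewrite mod0n modn_small.
Qed.

Lemma edge_set_ladder_input (m : nat) (Z : {set 'I_m.+1}) :
  0 < m -> edge_set (ladder_input Z) = ladder Z.
Proof.
move=> m0; apply/setP => E; rewrite inE; apply/hasP/idP.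
  by move=> [i _ /andP[+ /eqP <-]]; rewrite ffunE.
move=> EZ; have Ep : E \in pairs (m.+1 + m.+1).
  rewrite mem_filter mem_enum inE andbT.
  by case/imsetP: EZ => p _ ->; rewrite ladder_edge_card.
have iE : index E (pairs (m.+1 + m.+1)) < npairs (m.+1 + m.+1).
  by rewrite /npairs index_mem.
exists (Ordinal iE); first by rewrite mem_enum.
by rewrite ffunE /= nth_index // EZ eqxx.
Qed.

(** A ladder edge starts in the column of one of its two endpoints, and whether it is present
    depends only on whether that column is in [Z]. So the bit of a pair is determined by two
    memberships. *)
Lemma ladder_input_degree (m : nat) (i : 'I_(npairs (m.+1 + m.+1))) :
  obs_degree_le 2 (fun Z : {set 'I_m.+1} => ladder_input Z i).
Proof.
pose E := nth set0 (pairs (m.+1 + m.+1)) i.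
have : E \in pairs (m.+1 + m.+1) by apply: mem_nth; exact: ltn_ord.
rewrite mem_filter => /andP[/cards2P[u [v [_ Euv]]] _].
pose col (w : 'I_(m.+1 + m.+1)) : 'I_m.+1 := inord (w %% m.+1).
pose F (j : 'I_m.+1) b := [exists s : bool, E == ladder_edge m s b j].
apply: (@eq_obs_degree_le _ _ _ (fun Z : {set 'I_m.+1} =>
    F (col u) (col u \in Z) || F (col v) (col v \in Z))).
  move=> Z; rewrite ffunE -/E; apply/orP/imsetP => [|[[s j] _ /= Ee]].
    by case=> /existsP[s /eqP Ee]; [exists (s, col u)|exists (s, col v)].
  have [uj|vj] : col u = j \/ col v = j.
    have : vertex m s j \in E by rewrite Ee !inE eqxx.
    have colv : col (vertex m s j) = j.
      by rewrite /col vertex_col modn_small // inord_val.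
    rewrite Euv !inE => /orP[] /eqP wj; [left|right]; rewrite -wj //.
  - by left; apply/existsP; exists s; rewrite uj Ee.
  - by right; apply/existsP; exists s; rewrite vj Ee.
apply: (@obs_degree_le_bind _ _ _ 1 1 _
    (fun b Z => F (col u) b || F (col v) (col v \in Z))).
  exact: obs_degree_le_mem.
by move=> b; apply: (obs_degree_le_comp (fun c => F (col u) b || F (col v) c));
  exact: obs_degree_le_mem.
Qed.

(* The side on which one arrives after [t] steps around the ladder, starting in
   column 0 on side [false]. *)
Definition side (m : nat) (Z : {set 'I_m.+1}) (t : nat) : bool :=
  odd (\sum_(i < t) (inord i \in Z)).

Lemma sideS (m : nat) (Z : {set 'I_m.+1}) (t : nat) :
  side Z t.+1 = side Z t (+) (inord t \in Z).
Proof. by rewrite /side big_ord_recr oddD oddb. Qed.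

Lemma side_full (m : nat) (Z : {set 'I_m.+1}) : side Z m.+1 = odd #|Z|.
Proof.
rewrite /side -sum1_card [in RHS]big_mkcond /=; congr odd.
by apply: eq_bigr => i _; rewrite inord_val; case: (i \in Z).
Qed.

(** Two laps: the first follows the ladder from column 0 on side [false], the second visits the
    other vertex of each column. The same enumeration serves both parities: the first lap ends at
    the start of the second if [#|Z|] is odd, and at its own start otherwise. *)
Definition tour (m : nat) (Z : {set 'I_m.+1}) (t : nat) : 'I_(m.+1 + m.+1) :=
  vertex m (side Z (t %% m.+1) (+) (m < t)) t.

Lemma tour_inj (m : nat) (Z : {set 'I_m.+1}) :
  {in [pred i | i < m.+1 + m.+1] &, injective (tour Z)}.
Proof.
move=> i j; rewrite !inE => im jm /vertex_inj[sij eij].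
(* The columns agree, so the [side] terms cancel and the laps agree too. *)
move: sij; rewrite eij => /addbI lij.
rewrite (divn_eq i m.+1) (divn_eq j m.+1) eij; congr (_ * _ + _).
have div_lt k : k < m.+1 + m.+1 -> k %/ m.+1 = (m < k) :> nat.
  move=> km; have [lekm|ltmk] := leqP k m; first by rewrite divn_small.
  apply/eqP; rewrite eqn_leq leq_divRL // mul1n ltmk andbT -ltnS ltn_divLR //.
  by rewrite mul2n -addnn.
by rewrite !div_lt // lij.
Qed.

Lemma tour_lo (m : nat) (Z : {set 'I_m.+1}) (i : nat) :
  i < m.+1 -> tour Z i = vertex m (side Z i) i.
Proof. by move=> im; rewrite /tour modn_small // ltnNge -ltnS im addbF. Qed.

Lemma tour_hi (m : nat) (Z : {set 'I_m.+1}) (i : nat) :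
  i < m.+1 -> tour Z (m.+1 + i) = vertex m (~~ side Z i) i.
Proof.
move=> im; rewrite /tour modnDl modn_small // leq_addr addbT.
by rewrite -(vertex_mod _ _ (_ + _)) modnDl vertex_mod.
Qed.

(** The two edges leaving column [i] are indexed by lap instead of by side, as the laps occupy
    opposite sides of each column. *)
Lemma ladder_tour (m : nat) (Z : {set 'I_m.+1}) (E : {set 'I_(m.+1 + m.+1)}) :
  (E \in ladder Z) =
  [exists i : 'I_m.+1, (E == [set tour Z i; vertex m (side Z i.+1) i.+1])
    || (E == [set tour Z (m.+1 + i); vertex m (~~ side Z i.+1) i.+1])].
Proof.
apply/imsetP/existsP => [[[s i] _ ->]|[i /orP[]/eqP ->]].
- exists i; rewrite tour_lo // tour_hi // sideS inord_val /ladder_edge /=.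
  rewrite -addNb; case: (altP (s =P side Z i)) => [->|]; first by rewrite eqxx.
  by case: s; case: (side Z i) => // _; rewrite eqxx orbT.
- by exists (side Z i, i) => //; rewrite tour_lo // sideS inord_val.
- exists (~~ side Z i, i) => //.
  by rewrite /ladder_edge /= tour_hi // sideS inord_val addNb.
Qed.

Lemma vertex_tour_lo (m : nat) (Z : {set 'I_m.+1}) (i : nat) :
  i < m -> vertex m (side Z i.+1) i.+1 = tour Z i.+1.
Proof. by move=> im; rewrite tour_lo. Qed.

Lemma vertex_tour_hi (m : nat) (Z : {set 'I_m.+1}) (i : nat) :
  i < m -> vertex m (~~ side Z i.+1) i.+1 = tour Z (m.+1 + i.+1).
Proof. by move=> im; rewrite tour_hi. Qed.

Lemma side0 (m : nat) (Z : {set 'I_m.+1}) : side Z 0 = false.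
Proof. by rewrite /side big_ord0. Qed.

Lemma vertex_full (m : nat) (s : bool) : vertex m s m.+1 = vertex m s 0.
Proof. by rewrite -vertex_mod modnn. Qed.

Lemma ladder_one_cycle (m : nat) (Z : {set 'I_m.+1}) :
  0 < m -> odd #|Z| -> one_cycle (ladder_input Z).
Proof.
move=> m0 oZ; exists (tour Z); split; first exact: tour_inj.
have lo i : i < m.+1 ->
    vertex m (side Z i.+1) i.+1 = tour Z (i.+1 %% (m.+1 + m.+1)).
  move=> im; rewrite modn_small; last first.
    by apply: leq_ltn_trans im _; rewrite addnS ltnS leq_addr.
  move: im; rewrite ltnS leq_eqVlt => /orP[/eqP ->|]; last exact: vertex_tour_lo.
  (* An odd number of crossings brings the end of the first lap to side [true] of column 0, where
     the second lap begins. *)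
  by rewrite -[in RHS](addn0 m.+1) tour_hi // side_full oZ side0 vertex_full.
have hi i : i < m.+1 ->
    vertex m (~~ side Z i.+1) i.+1 = tour Z ((m.+1 + i).+1 %% (m.+1 + m.+1)).
  rewrite ltnS leq_eqVlt -addnS => /orP[/eqP ->|im].
    by rewrite modnn tour_lo // side_full oZ side0 vertex_full.
  by rewrite modn_small ?vertex_tour_hi // ltn_add2l.
rewrite edge_set_ladder_input //; apply/setP => E; rewrite ladder_tour.
apply/existsP/imsetP => [[i /orP[]/eqP ->]|[t _ ->]].
- by exists (lshift _ i); rewrite //= lo.
- by exists (rshift _ i); rewrite //= hi.
- rewrite -(splitK t); case: (split t) => i; exists i; apply/orP; [left|right].
    by rewrite lo.
  by rewrite hi.
Qed.

Lemma ladder_two_cycles (m : nat) (Z : {set 'I_m.+1}) :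
  0 < m -> ~~ odd #|Z| -> two_cycles (ladder_input Z).
Proof.
move=> m0 /negbTE eZ; rewrite /two_cycles.
have -> : (m.+1 + m.+1)./2 = m.+1 by rewrite addnn doubleK.
exists (tour Z); split; first exact: tour_inj.
have lo i : i < m.+1 ->
    vertex m (side Z i.+1) i.+1 = tour Z (i.+1 %% m.+1).
  rewrite ltnS leq_eqVlt => /orP[/eqP ->|im].
    by rewrite modnn tour_lo // side_full eZ side0 vertex_full.
  by rewrite modn_small // vertex_tour_lo.
have hi i : i < m.+1 ->
    vertex m (~~ side Z i.+1) i.+1 = tour Z (m.+1 + i.+1 %% m.+1).
  rewrite ltnS leq_eqVlt => /orP[/eqP ->|im].
    by rewrite modnn tour_hi // side_full eZ side0 vertex_full.
  by rewrite modn_small // vertex_tour_hi.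
rewrite edge_set_ladder_input //; apply/setP => E; rewrite ladder_tour inE.
apply/existsP/orP => [[i /orP[]/eqP ->]|[]/imsetP[i _ ->]].
- by left; apply/imsetP; exists i; rewrite // lo.
- by right; apply/imsetP; exists i; rewrite // hi.
- by exists i; rewrite lo // eqxx.
- by exists i; rewrite hi // eqxx orbT.
Qed.

(** * Averaging over the ladders *)

From mathcomp Require Import all_classical all_reals all_analysis.
From mathcomp Require Import measurable_realfun lra.
Import Order.TTheory GRing.Theory Num.Theory.
Local Open Scope classical_set_scope.
Local Open Scope ring_scope.

(* The signed answer has degree below the number of columns, hence is
   orthogonal to the parity of [Z]; so it agrees with the parity no more often
   than it disagrees. *)
Lemma correct_at_most_half (S : nat) (A : algorithm) (m : nat)
    (C : {set {set 'I_m.+1}}) :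
  valid_alg S A (m.+1 + m.+1) -> (2 * (S * S) ^ rounds A < m.+1)%N ->
  (forall Z, Z \in C -> outputs S A (ladder_input Z) (odd #|Z|)) ->
  (2 * #|C| <= #|{set 'I_m.+1}|)%N.
Proof.
move=> vA lt_m outC.
(* The answer bit [b] is encoded as the sign [(-1) ^ b], any other content as 0. The product with
   the parity sign is then 1 on correct answers and at least -1 always. *)
pose g (v : seq nat) : int := (v == [:: 0%N])%:R - (v == [:: 1%N])%:R.
pose f (Z : {set 'I_m.+1}) :=
  g (run_store S A (ladder_input Z) (rounds A) answer_key).
have f0 : \sum_(Z : {set 'I_m.+1}) (-1) ^+ #|Z| * f Z = 0.
  apply: (@sum_sign_degree_lt _ (2 * (S * S) ^ rounds A)); rewrite ?card_ord //.
  by apply: run_store_degree => // i; exact: ladder_input_degree.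
have fC Z : Z \in C -> (-1) ^+ #|Z| * f Z = 1.
  move=> /outC/(outputs_run_store vA); rewrite /f /g => ->.
  by rewrite -signr_odd; case: (odd _).
have fN (Z : {set 'I_m.+1}) : -1 <= (-1) ^+ #|Z| * f Z.
  rewrite -signr_odd /f /g.
  move: (run_store _ _ _ _ _) => v.
  by case: (odd _); case: eqP => [->|_] //; case: eqP.
(* The left side is [2 * #|C|] minus the number of all [Z], and the right side is 0. *)
have : \sum_(Z : {set 'I_m.+1}) ((Z \in C)%:R *+ 2 - 1 : int)
    <= \sum_(Z : {set 'I_m.+1}) (-1) ^+ #|Z| * f Z.
  apply: ler_sum => Z _; case: (boolP (Z \in C)) => [/fC -> //|_].
  exact: fN.
rewrite f0 big_split /= sumrMnl -natr_sum -big_mkcond sum1_card sumr_const.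
by rewrite mulNrn subr_le0 -mulrnA ler_nat mulnC.
Qed.

(** The sum of probabilities is the expected number of events that occur, and at every point at most
    [c] of them do. *)
Lemma sum_probability_le (R : realType) (d : measure_display)
    (T : measurableType d) (P : probability T R) (J : finType)
    (E : J -> set T) (c : nat) :
  (forall j, measurable (E j)) ->
  (forall w (C : {set J}), (forall j, j \in C -> E j w) -> (#|C| <= c)%N) ->
  (\sum_(j : J) P (E j) <= (c%:R : R)%:E)%E.
Proof.
move=> mE Ec.
have mI j : measurable_fun setT (fun w => (\1_(E j) w : R)%:E).
  by apply/measurable_EFinP; exact: measurable_indic.
have -> : (\sum_j P (E j) = \int[P]_w \sum_j (\1_(E j) w)%:E)%E.
  rewrite ge0_integral_sum //=.
  by apply: eq_bigr => j _; rewrite integral_indic ?setIT.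
have <- : (\int[P]_w (c%:R : R)%:E = (c%:R : R)%:E)%E.
  by rewrite integral_cst //= probability_setT mule1.
apply: ge0_le_integral => //.
- by move=> w _; apply: sume_ge0 => j _; rewrite lee_fin.
- exact: emeasurable_sum.
- move=> w _; rewrite sumEFin lee_fin.
  pose C := [set j | w \in E j]%SET.
  rewrite (_ : \sum_j _ = #|C|%:R).
    by rewrite ler_nat; apply: (Ec w) => j; rewrite inE => /set_mem.
  rewrite -sum1_card natr_sum [RHS]big_mkcond /=.
  by apply: eq_bigr => j _; rewrite indicE inE; case: (w \in E j).
Qed.

(** Multiplying by [6 * ln S] and exponentiating turns the term with factor [2^-1] into [3 * ln 2],
    whence the constant [8]. *)
Lemma rounds_lt_log (R : realType) (n S r : nat) :
  (2 <= S)%N ->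
  r%:R < 6^-1 * (ln (n%:R : R) / ln S%:R) - 2^-1 * (ln (2 : R) / ln S%:R) ->
  (8 * S ^ (6 * r) < n)%N.
Proof.
move=> S2 lt_r.
have S0 : 0 < S%:R :> R by rewrite ltr0n ltnW.
have lnS : 0 < ln S%:R :> R by rewrite ln_gt0 // ltr1n.
have ln2 : 0 < ln 2 :> R by rewrite ln_gt0 // ltr1n.
have lt_ln : 3 * ln 2 + 6 * r%:R * ln S%:R < ln n%:R :> R.
  rewrite -(ltr_pM2r lnS) in lt_r.
  move: lt_r; rewrite mulrBl -!mulrA !mulVf ?gt_eqF // !mulr1 => lt_r.
  lra.
(* Here [ln 0 = 0], so [n = 0] would make [lt_ln] bound a positive number by 0. *)
have n0 : (0 < n)%N.
  rewrite lt0n; apply/eqP => n0; move: lt_ln; rewrite n0 (@ln0 _ 0%:R) // -mulrA.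
  have : 0 <= r%:R * ln S%:R :> R by rewrite mulr_ge0 ?ler0n // ltW.
  by move: (r%:R * _) => a; lra.
rewrite -(ltr_nat R) -ltr_ln ?posrE ?ltr0n ?muln_gt0 ?expn_gt0 ?(ltnW S2) //.
rewrite natrM lnM ?posrE ?ltr0n ?expn_gt0 ?(ltnW S2) // natrX lnXn //.
rewrite (_ : 8%:R = 2 ^+ 3 :> R) ?lnXn //; last by rewrite -natrX.
by rewrite -[ln 2 *+ _]mulr_natl -[ln S%:R *+ _]mulr_natl natrM.
Qed.

Theorem theorem5p13 (n S : nat) (R : realType) (d : measure_display)
  (T : measurableType d) (P : probability T R) (A : T -> algorithm) (r : nat) :
  ~~ odd n -> (2 <= S)%N ->
  (forall w, valid_alg S (A w) n) ->
  (forall w, (rounds (A w) <= r)%N) ->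
  (forall x : input n, one_cycle x ->
     measurable [set w | outputs S (A w) x true] /\
     ((1 - 6^-1 : R)%:E <= P [set w | outputs S (A w) x true])%E) ->
  (forall x : input n, two_cycles x ->
     measurable [set w | outputs S (A w) x false] /\
     ((1 - 6^-1 : R)%:E <= P [set w | outputs S (A w) x false])%E) ->
  6^-1 * (ln (n%:R : R) / ln (S%:R)) - 2^-1 * (ln (2 : R) / ln (S%:R)) <= r%:R.
Proof.
move=> evn S2 vA rA one two; rewrite leNgt; apply/negP => /(rounds_lt_log S2).
have [m nE] : exists m, n = (m + m)%N.
  by exists n./2; rewrite addnn even_halfK.
subst n; case: m => [//|m] in evn vA one two *; move=> lt_n.
(* [4 * S ^ (2 * r) <= 8 * S ^ (6 * r) < n], and [n] is twice the number of columns. *)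
have lt_m : (2 * (S * S) ^ r < m.+1)%N.
  have le_S : ((S * S) ^ r <= S ^ (6 * r))%N.
    by rewrite mulnn -expnM leq_pexp2l ?leq_mul2r ?orbT // ltnW.
  rewrite -(ltn_pmul2l (isT : 0 < 2)%N) mulnA (mul2n m.+1) -addnn.
  apply: leq_ltn_trans lt_n; exact: leq_mul.
have m0 : (0 < m)%N.
  rewrite -ltnS (leq_trans _ lt_m) // ltnS.
  by rewrite muln_gt0 expn_gt0 muln_gt0 (ltnW S2).
pose E (Z : {set 'I_m.+1}) :=
  [set w | outputs S (A w) (ladder_input Z) (odd #|Z|)].
have EP Z : measurable (E Z) /\ ((1 - 6^-1 : R)%:E <= P (E Z))%E.
  rewrite /E; case: (boolP (odd #|Z|)) => oZ.
    by apply: one; exact: ladder_one_cycle.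
  by apply: two; exact: ladder_two_cycles.
pose c := #|{set 'I_m.+1}|.
have Ec w (C : {set {set 'I_m.+1}}) :
    (forall Z, Z \in C -> E Z w) -> (#|C| <= c./2)%N.
  move=> CE; rewrite -[#|C|]doubleK half_leq // -mul2n.
  apply: (correct_at_most_half (vA w)) => //.
  apply: leq_ltn_trans lt_m; rewrite leq_mul2l leq_pexp2l ?rA //.
  by rewrite muln_gt0 (ltnW S2).
have := sum_probability_le P (fun Z => (EP Z).1) Ec.
rewrite leNgt => /negP; apply.
have c0 : (0 < c)%N by apply/card_gt0P; exists finset.set0.
have half_c : c./2%:R + c./2%:R <= c%:R :> R.
  by rewrite -natrD ler_nat addnn -{2}(odd_double_half c) leq_addl.
(* The success probabilities sum to at least [5/6] of [c], against the upper bound [c./2] by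
   counting. *)
apply: (@lt_le_trans _ _ (\sum_(Z : {set 'I_m.+1}) (1 - 6^-1 : R)%:E)%E).
  rewrite sumEFin lte_fin sumr_const -mulr_natl -/c.
  have : 0 < c%:R :> R by rewrite ltr0n.
  lra.
by apply: lee_sum => Z _; exact: (EP Z).2.
Qed.
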